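(* Let $k$ be a field, $n\le m$, $R=k[x_{ij}\mid 1\le i\le n,\ 1\le j\le m]$, $M=(x_{ij})$ the $n\times m$ matrix of variables, and $<$ any term order on $R$. For $\ell>0$, the multidegrees appearing in homological degree $\ell$ of the sparse Eagon–Northcott complex $E^<_\bullet$ are exactly the degree $n+\ell-1$ monomials $x_{1\mathbf b_1}\cdots x_{n\mathbf b_n}$ with the property that $$x_{1c_1}x_{2c_2}\cdots x_{nc_n}\in G(\operatorname{in}_<I_n(M))\quad\text{for all choices of } c_j\in\mathbf b_j,\ j=1,\dots,n.$$
   Context: Here $\mathbf b_1,\dots,\mathbf b_n$ are nonempty subsets of $[m]$ and $x_{i\mathbf b_i}=\prod_{b\in\mathbf b_i}x_{ib}$. $I_n(M)$ is the ideal of maximal minors of $M$, and $G(\cdot)$ denotes the minimal monomial generating set of a monomial ideal. Eagon–Northcott complex $E_\bullet$: let $F=R^m$ with basis $f_1,\dots,f_m$ and $G=R^n$ with basis $g_1,\dots,g_n$. Then $E_0=R$, $E_\ell=D_{\ell-1}(G^* )\otimes\bigwedge^{n+\ell-1}F$ for $1\le\ell\le m-n+1$, with basis $g^{*(\alpha)}\otimes f_I$, $\alpha\in\mathbb Z_{\ge0}^n$, $|\alpha|=\ell-1$, $I\subseteq[m]$, $|I|=n+\ell-1$. The differential is $f_I\mapsto[I]$ (the maximal minor on columns $I$) in degree $1$ and $g^{*(\alpha)}\otimes f_I\mapsto\sum_{i:\alpha_i>0}\sum_{j\in I}\pm x_{ij}\,g^{*(\alpha-\epsilon_i)}\otimes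 f_{I\setminus j}$ in degrees $\ge2$, where the sign is $(-1)^{p+1}$ if $j$ is the $p$-th smallest element of $I$. Sparse Eagon–Northcott complex $E^<_\bullet$: the complex obtained by homogenizing $E_\bullet$ with respect to $<$ using a new variable $t$ and then setting $t=0$. Explicitly, it has the same free modules and bases; multidegrees (monomials of $R$) are assigned inductively: $\operatorname{mdeg}(f_I)$ is the lead monomial of $[I]$, and $f_I$ maps to the lead term of $[I]$; if $e$ is a basis element in homological degree $\ge2$ with $d^E(e)=\sum_s\pm y_s e_s$ ($y_s$ variables, $e_s$ basis elements), then $\operatorname{mdeg}(e)$ is the $<$-largest of the monomials $y_s\operatorname{mdeg}(e_s)$, and $d^<(e)$ consists of exactly those terms $\pm y_se_s$ with $y_s\operatorname{mdeg}(e_s)=\operatorname{mdeg}(e)$. (By a result of Boocher, $E^<_\bullet$ is the minimal free resolution of $R/\operatorname{in}_<I_n(M)$.) *)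

(* Defs.v *)
From HB Require Import structures.
From mathcomp Require Import all_boot all_order all_algebra.
From mathcomp Require Export mpoly.

Set Implicit Arguments.
Unset Strict Implicit.
Unset Printing Implicit Defensive.

Import GRing.Theory.
Local Open Scope ring_scope.

(* Monomials are exponent vectors 'X_{1..N}, written additively: a product of
   monomials is a sum in %MM and the monomial 1 is 0%MM. *)
(* [tle] is the non-strict version of the term order. *)
Record term_order (N : nat) := TermOrder {
  tle :> rel 'X_{1..N};
  tle_anti  : antisymmetric tle;
  tle_trans : transitive tle;
  tle_total : total tle;
  tle_add   : forall a b c : 'X_{1..N}, tle a b -> tle (a + c)%MM (b + c)%MM;
  tle_min   : forall a : 'X_{1..N}, tle 0%MM a
}.

Section TermOrders.
Variables (k : fieldType) (N : nat) (lt : term_order N).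

Definition tmax (a b : 'X_{1..N}) : 'X_{1..N} := if lt a b then b else a.

(* Junk value 0%MM (the monomial 1, the smallest one) for the zero polynomial. *)
Definition lead_mon (f : {mpoly k[N]}) : 'X_{1..N} :=
  \big[tmax/0%MM]_(a <- msupp f) a.

Definition lead_term (f : {mpoly k[N]}) : {mpoly k[N]} :=
  f@_(lead_mon f) *: 'X_[lead_mon f].

Definition ideal_gen (S : {mpoly k[N]} -> Prop) (f : {mpoly k[N]}) : Prop :=
  exists (r : nat) (c g : 'I_r -> {mpoly k[N]}),
    (forall i, S (g i)) /\ f = \sum_(i < r) c i * g i.

Definition initial_ideal (J : {mpoly k[N]} -> Prop) : {mpoly k[N]} -> Prop :=
  ideal_gen (fun p => exists f, [/\ J f, f != 0 & p = lead_term f]).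

Definition mon_gens (J : {mpoly k[N]} -> Prop) (A : 'X_{1..N} -> Prop) : Prop :=
  forall f : {mpoly k[N]},
    J f <-> ideal_gen (fun p => exists2 a, A a & p = 'X_[a]) f.

Definition min_mon_gens (J : {mpoly k[N]} -> Prop) (A : 'X_{1..N} -> Prop) : Prop :=
  mon_gens J A /\
  forall B : 'X_{1..N} -> Prop,
    (forall a, B a -> A a) -> mon_gens J B -> forall a, A a -> B a.

(* Membership in G(J); a monomial ideal J has exactly one minimal monomial
   generating set. *)
Definition in_G (J : {mpoly k[N]} -> Prop) (a : 'X_{1..N}) : Prop :=
  exists2 A, min_mon_gens J A & A a.

(* A complex of based finite free modules over k[x_1, ..., x_N]:
   [cdiff e e'] is the coefficient of e' in the differential of e.  Only the data is
   recorded; d o d = 0 is not a field. *)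
Record based_complex := BasedComplex {
  cbasis : nat -> finType;
  cdiff  : forall l, cbasis l.+1 -> cbasis l -> {mpoly k[N]}
}.

Record multigraded_complex := MultigradedComplex {
  mgc    :> based_complex;
  mgmdeg : forall l, cbasis mgc l -> 'X_{1..N}
}.

Definition multidegree_in (E : multigraded_complex) (l : nat) (a : 'X_{1..N}) :=
  exists e : cbasis E l, mgmdeg e = a.

Section Sparse.
Variable E : based_complex.

(* In degree 0 every basis element has multidegree 1. *)
Fixpoint sparse_mdeg (l : nat) : cbasis E l -> 'X_{1..N} :=
  match l with
  | 0 => fun _ => 0%MM
  | l'.+1 => fun e =>
      \big[tmax/0%MM]_(e' : cbasis E l' | cdiff e e' != 0)
         (lead_mon (cdiff e e') + sparse_mdeg e')%MM
  end.

(* Homogenizing with respect to the term order and setting t = 0 keeps, in each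
   coefficient, the lead term if it attains the multidegree and 0 otherwise. *)
Definition sparse_diff (l : nat) (e : cbasis E l.+1) (e' : cbasis E l) :
    {mpoly k[N]} :=
  if (lead_mon (cdiff e e') + sparse_mdeg e')%MM == sparse_mdeg e
  then lead_term (cdiff e e') else 0.

Definition sparse : multigraded_complex :=
  @MultigradedComplex (BasedComplex sparse_diff) sparse_mdeg.

End Sparse.
End TermOrders.

Section EagonNorthcott.
Variables (k : fieldType) (n m : nat).

Definition var_idx (i : 'I_n) (j : 'I_m) : 'I_(n * m) := mxvec_index i j.

Definition generic_mx : 'M[{mpoly k[n * m]}]_(n, m) :=
  \matrix_(i, j) 'X_(var_idx i j).

(* [enum_val] lists the elements of I in increasing order. *)
Definition max_minor (I : {set 'I_m}) (hI : #|I| = n) : {mpoly k[n * m]} :=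
  \det (colsub (fun r : 'I_n => enum_val (cast_ord (esym hI) r)) generic_mx).

Definition minors_ideal : {mpoly k[n * m]} -> Prop :=
  ideal_gen (fun p => exists (I : {set 'I_m}) (hI : #|I| = n), p = max_minor hI).

(* The pair (alpha, I) stands for g^*(alpha) (x) f_I in degree l.+1; the bound
   in 'X_{1..n < l.+1} only serves finiteness. *)
Definition EN_gen (l : nat) :=
  {e : 'X_{1..n < l.+1} * {set 'I_m} | (mdeg e.1 == l) && (#|e.2| == l + n)%N}.

Definition EN_alpha l (e : EN_gen l) : 'X_{1..n} := (val e).1.
Definition EN_set l (e : EN_gen l) : {set 'I_m} := (val e).2.

Lemma EN_set_card l (e : EN_gen l) : #|EN_set e| = (l + n)%N.
Proof. by case/andP: (valP e) => _ /eqP. Qed.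

Definition EN_basis (l : nat) : finType :=
  match l with
  | 0 => unit
  | l'.+1 => EN_gen l'
  end.

Definition EN_pos (I : {set 'I_m}) (j : 'I_m) : nat :=
  #|[set j' in I | (j' <= j)%N]|.

Definition EN_diff (l : nat) : EN_basis l.+1 -> EN_basis l -> {mpoly k[n * m]} :=
  match l with
  | 0 => fun e _ => max_minor (EN_set_card e)
  | l'.+1 => fun e e' =>
      \sum_(i < n | (0 < EN_alpha e i)%N) \sum_(j in EN_set e)
        if (EN_alpha e' == (EN_alpha e - U_(i))%MM) &&
           (EN_set e' == EN_set e :\ j)
        then (-1) ^+ (EN_pos (EN_set e) j).+1 * 'X_(var_idx i j) else 0
  end.

Definition eagon_northcott : based_complex k (n * m) := BasedComplex EN_diff.

Definition sparse_eagon_northcott (lt : term_order (n * m)) :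
    multigraded_complex k (n * m) :=
  sparse lt eagon_northcott.

End EagonNorthcott.

Arguments minors_ideal k n m : clear implicits.

(* The monomial x_{1 b_1} ... x_{n b_n}. *)
Definition sets_mon (n m : nat) (b : 'I_n -> {set 'I_m}) : 'X_{1..n * m} :=
  (\sum_(i < n) \sum_(j in b i) U_(var_idx i j))%MM.

(* The monomial x_{1 c_1} ... x_{n c_n}. *)
Definition choice_mon (n m : nat) (c : 'I_n -> 'I_m) : 'X_{1..n * m} :=
  (\sum_(i < n) U_(var_idx i (c i)))%MM.

(* Main.v *)
Require Import Defs.
From mathcomp Require Import all_boot all_order all_algebra mpoly.
From mathcomp Require Import all_fingroup.
From Stdlib Require Import Classical.

(* Unrolling the recursion, the multidegree of [g^*(alpha) (x) f_I] is the largest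
   monomial [prod_(j in I) x_(phi j) j] over the assignments [phi] of the columns in
   [I] to rows that give [alpha i + 1] columns to row [i].  An assignment is largest
   among those with the same fibre sizes iff each choice of one column per row is:
   permuting a choice permutes part of the assignment, and conversely two assignments
   with the same fibre sizes differ by row cycles, each of which permutes a choice.
   Finally [x_(1 c_1) ... x_(n c_n)] is a minimal generator of the initial ideal iff it
   is the largest among its row permutations.  This only concerns the lowest degree [n]
   of the initial ideal, where elements of [I_n(M)] are scalar combinations of minors
   and hence alternating in the rows, so no Groebner basis is needed. *)

Set Implicit Arguments.
Unset Strict Implicit.
Unset Printing Implicit Defensive.

(** * Term orders: cancellation and maxima of finite families *)

Section TermOrder.
Import GRing.Theory.
Local Open Scope ring_scope.

Variables (N : nat) (lt : term_order N).
Implicit Types a b c : 'X_{1..N}.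

Lemma tle_refl a : lt a a.
Proof. by case/orP: (tle_total lt a a). Qed.

Lemma tle_add2r a b c : lt (a + c)%MM (b + c)%MM = lt a b.
Proof.
apply/idP/idP => [le_ac_bc|]; last exact: tle_add.
have [//|le_ba] := orP (tle_total lt a b).
have/addIm-> : (a + c = b + c)%MM; last exact: tle_refl.
by apply: (tle_anti (t := lt)); rewrite le_ac_bc tle_add.
Qed.

Lemma tle_add2l a b c : lt (c + a)%MM (c + b)%MM = lt a b.
Proof. by rewrite ![(c + _)%MM]addmC tle_add2r. Qed.

Lemma tmaxl a b : lt a (tmax lt a b).
Proof. by rewrite /tmax; case: ifP => // _; apply: tle_refl. Qed.

Lemma tmaxr a b : lt b (tmax lt a b).
Proof.
rewrite /tmax; case: ifP => [_|nle]; first exact: tle_refl.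
by have := tle_total lt a b; rewrite nle.
Qed.

Variables (I : eqType) (r : seq I) (P : pred I) (F : I -> 'X_{1..N}).

Lemma tle_bigtmax i : i \in r -> P i ->
  lt (F i) (\big[tmax lt/0%MM]_(j <- r | P j) F j).
Proof.
elim: r => [//|j s IHs]; rewrite big_cons inE => /orP[/eqP<- -> | i_s Pi].
  exact: tmaxl.
case: ifP => _; last exact: IHs.
exact: tle_trans (IHs i_s Pi) (tmaxr _ _).
Qed.

(** The default [0%MM] is the least monomial, so if the fold returns it, every admissible [F i]
    equals it. *)
Lemma bigtmax_attained i : i \in r -> P i ->
  exists2 j, (j \in r) && P j & \big[tmax lt/0%MM]_(j <- r | P j) F j = F j.
Proof.
move=> ir Pi; pose G x := x = 0%MM \/ exists2 j, (j \in r) && P j & x = F j.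
have : G (\big[tmax lt/0%MM]_(j <- r | P j) F j).
  rewrite big_seq_cond; apply: big_ind => [|x y|j jP]; first by left.
    by rewrite /tmax; case: ifP.
  by right; exists j.
case=> // max0; exists i; first by rewrite ir.
have := tle_bigtmax ir Pi; rewrite max0 => le_Fi0.
by apply: (tle_anti (t := lt)); rewrite le_Fi0 tle_min.
Qed.

End TermOrder.

(** * Lead monomials, initial ideals and minimal monomial generators *)

Section Ideals.
Import GRing.Theory.
Local Open Scope ring_scope.
Variables (k : fieldType) (N : nat) (lt : term_order N).
Implicit Types (a b c : 'X_{1..N}) (f g p : {mpoly k[N]}).
Implicit Types (S J : {mpoly k[N]} -> Prop) (A : 'X_{1..N} -> Prop).

Lemma lead_mon_ge f a : a \in msupp f -> lt a (lead_mon lt f).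
Proof. by move=> af; apply: (@tle_bigtmax _ _ _ _ predT id). Qed.

Lemma lead_mon_supp f : f != 0 -> lead_mon lt f \in msupp f.
Proof.
rewrite -msupp_eq0 -size_eq0 -lt0n -has_predT => /hasP[a af _].
have [b /andP[bf _] eqb] := @bigtmax_attained _ lt _ _ predT id _ af isT.
by rewrite /lead_mon eqb.
Qed.

Lemma lead_mon_eq f a :
  a \in msupp f -> (forall b, b \in msupp f -> lt b a) -> lead_mon lt f = a.
Proof.
move=> af amax; apply: (tle_anti (t := lt)); rewrite lead_mon_ge // amax //.
by apply: lead_mon_supp; apply: contraTneq af => ->; rewrite msupp0.
Qed.

Lemma lead_monZX (x : k) a : x != 0 -> lead_mon lt (x *: 'X_[a]) = a.
Proof.
move=> x0; apply: lead_mon_eq; rewrite msuppMCX // ?mem_head // => b.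
by rewrite inE => /eqP->; apply: tle_refl.
Qed.

Lemma ideal_genM S g p : S g -> ideal_gen S (p * g).
Proof. by move=> Sg; exists 1%N, (fun=> p), (fun=> g); rewrite big_ord1. Qed.

Lemma ideal_gen_sub S J f :
  (forall g, S g -> ideal_gen J g) -> ideal_gen S f -> ideal_gen J f.
Proof.
move=> SJ [r [c [g [Sg ->]]]]; elim: r c g Sg => [|r IHr] c g Sg.
  by exists 0%N, (fun=> 0), (fun=> 0); split=> [[]|]; rewrite ?big_ord0.
rewrite big_ord_recl.
have [r1 [c1 [g1 [Jg1 ->]]]] := SJ _ (Sg ord0).
have [r2 [c2 [g2 [Jg2 ->]]]] :=
  IHr (fun i => c (lift ord0 i)) (fun i => g (lift ord0 i)) (fun i => Sg _).
pose C i := match split i with inl i1 => c ord0 * c1 i1 | inr i2 => c2 i2 end.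
pose G i := match split i with inl i1 => g1 i1 | inr i2 => g2 i2 end.
exists (r1 + r2)%N, C, G; split=> [i|]; first by rewrite /G; case: split.
rewrite big_split_ord mulr_sumr; congr (_ + _); apply: eq_bigr => i _.
  by rewrite /C /G (unsplitK (inl i)) mulrA.
by rewrite /C /G (unsplitK (inr i)).
Qed.

Lemma ideal_gen_supp S f a : ideal_gen S f -> a \in msupp f ->
  exists g b, [/\ S g, b \in msupp g & (b <= a)%MM].
Proof.
move=> [r [c [g [Sg ->]]]] /msupp_sum_le/flattenP[_ /mapP[i _ ->]].
move=> /msuppM_le/allpairsP[[m1 m2] /= [_ m2g ->]].
by exists (g i), m2; rewrite lem_addl.
Qed.

(* A monomial whose degree is the least one in [g] only meets the constant term of
   a multiplier. *)
Lemma mcoeffM_low p g a :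
    (forall b, b \in msupp g -> (mdeg a <= mdeg b)%N) ->
  (p * g)@_a = p@_0 * g@_a.
Proof.
move=> low; rewrite {1}[p]mpolyE mulr_suml raddf_sum /=.
have XM b : ((p@_b *: 'X_[b]) * g)@_a = (b == 0%MM)%:R * (p@_0 * g@_a).
  rewrite -scalerAl mcoeffZ; have [->|b0] := eqVneq b 0%MM.
    by rewrite mpolyX0 !mul1r.
  rewrite mul0r; apply/eqP; rewrite mulf_eq0 orbC mcoeff_eq0; apply/orP; left.
  apply/negP => /msuppM_le/allpairsP[[m1 m2] /= [+ m2g am]].
  rewrite msuppX inE => /eqP m1b; move: (low _ m2g).
  rewrite am mdegD m1b -[X in (_ <= X)%N]add0n leq_add2r leqn0 mdeg_eq0.
  by rewrite (negPf b0).
rewrite (eq_bigr _ (fun b _ => XM b)) -mulr_suml -natr_sum.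
have [p0|p0] := boolP (0%MM \in msupp p).
  rewrite (bigD1_seq 0%MM) ?msupp_uniq //= big1 ?eqxx ?mul1r // => b.
  by move/negPf->.
by move: p0; rewrite -mcoeff_eq0 => /eqP->; rewrite mul0r mulr0.
Qed.

Lemma lead_term_initial J f : J f -> f != 0 ->
  initial_ideal lt J 'X_[lead_mon lt f].
Proof.
move=> Jf f0; have u0 : f@_(lead_mon lt f) != 0.
  by rewrite -mcoeff_msupp lead_mon_supp.
rewrite -[X in initial_ideal lt J X](scalerK u0) -mul_mpolyC.
by apply: ideal_genM; exists f.
Qed.

Lemma initial_supp J f a : initial_ideal lt J f -> a \in msupp f ->
  exists h, [/\ J h, h != 0 & (lead_mon lt h <= a)%MM].
Proof.
move=> inf /(ideal_gen_supp inf)[g [b [[h [Jh h0 ->]] + le_ba]]].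
move/msuppZ_le; rewrite msuppX inE => /eqP bE.
by exists h; rewrite -bE.
Qed.

Definition minimal_mon J a :=
  J 'X_[a] /\ forall b, J 'X_[b] -> (b <= a)%MM -> b = a.

Lemma initial_gen J g :
  ideal_gen (fun p => exists2 a, initial_ideal lt J 'X_[a] & p = 'X_[a]) g ->
  initial_ideal lt J g.
Proof. by apply: ideal_gen_sub => _ [a Ja ->]. Qed.

Lemma mdeg_lem a b : (a <= b)%MM -> (mdeg a <= mdeg b)%N.
Proof. by move/submK<-; rewrite mdegD leq_addl. Qed.

Lemma lem_mdeg_eq a b : (a <= b)%MM -> (mdeg b <= mdeg a)%N -> a = b.
Proof.
move=> le_ab le_deg; rewrite -[RHS](submK le_ab).
suff /eqP-> : (b - a == 0)%MM by rewrite add0m.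
by rewrite -mdeg_eq0 -leqn0 -(leq_add2r (mdeg a)) -mdegD submK.
Qed.

Lemma exists_minimal_mon J a : J 'X_[a] ->
  exists2 b, minimal_mon J b & (b <= a)%MM.
Proof.
have [d] := ubnP (mdeg a); elim: d a => // d IHd a lt_ad Ja.
have [a_min|] := classic (minimal_mon J a); first by exists a; rewrite ?lepm_refl.
move/not_and_or; case=> [/(_ Ja)//|/not_all_ex_not[b nb]].
have [Jb {}nb] := imply_to_and _ _ nb; have [le_ba ba] := imply_to_and _ _ nb.
have lt_bd : (mdeg b < d)%N.
  rewrite ltnS in lt_ad; apply: leq_trans lt_ad.
  by rewrite ltnNge; apply/negP => /(lem_mdeg_eq le_ba).
have [c c_min le_cb] := IHd b lt_bd Jb.
by exists c; last exact: lepm_trans le_ba.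
Qed.

Lemma in_G_initialP J a :
  in_G (initial_ideal lt J) a <-> minimal_mon (initial_ideal lt J) a.
Proof.
set K := initial_ideal lt J; pose gen A p := exists2 b, A b & p = 'X_[b] :> {mpoly k[N]}.
have genX A f b : ideal_gen (gen A) f -> b \in msupp f -> exists2 c, A c & (c <= b)%MM.
  move=> /ideal_gen_supp/[apply] -[_ [c [[d Ad ->] + le_cb]]].
  by rewrite msuppX inE => /eqP cd; exists d; rewrite // -cd.
have XK b : b \in msupp ('X_[b] : {mpoly k[N]}) by rewrite msuppX mem_head.
have gen_sub A : (forall b, A b -> K 'X_[b]) -> forall f, ideal_gen (gen A) f -> K f.
  move=> AK f fA; apply: initial_gen; apply: ideal_gen_sub fA => _ [b Ab ->].
  by rewrite -['X_[b]]mul1r; apply: ideal_genM; exists b; first exact: AK.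
have genA A b : A b -> ideal_gen (gen A) 'X_[b].
  by move=> Ab; rewrite -['X_[b]]mul1r; apply: ideal_genM; exists b.
split=> [[A [Agen Amin] Aa] | amin].
  split=> [|b Kb le_ba]; first exact/Agen/genA.
  apply: NNPP => ba.
  have [c Ac le_cb] := genX _ _ _ ((Agen _).1 Kb) (XK b).
  have ca : c <> a.
    move=> ca; apply: ba; apply/mnmP => i; apply/eqP; rewrite eqn_leq.
    by rewrite (mnm_lepP le_ba) -{1}ca (mnm_lepP le_cb).
  pose B d := A d /\ d <> a.
  have [//|f|_ []//] := Amin B _ _ a Aa; first by move=> d [].
  split=> [/Agen|fB]; last first.
    by apply/Agen; apply: ideal_gen_sub fB => _ [d [Ad _] ->]; apply: genA.
  apply: ideal_gen_sub => _ [d Ad ->].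
  have [->|da] := eqVneq d a; last by apply: genA; split=> //; apply/eqP.
  rewrite -(submK (lepm_trans le_cb le_ba)) mpolyXD; apply: ideal_genM.
  by exists c.
exists (minimal_mon K) => //; split=> [f|B Bmin Bgen b [Kb bmin]].
  split; last by apply: gen_sub => b [].
  apply: ideal_gen_sub => _ [h [Jh h0 ->]].
  have [b bmin le_bh] := exists_minimal_mon (lead_term_initial Jh h0).
  rewrite /lead_term -(submK le_bh) mpolyXD scalerAl; apply: ideal_genM.
  by exists b.
have [c Bc le_cb] := genX _ _ _ ((Bgen _).1 Kb) (XK b).
by rewrite -(bmin c) //; apply/Bgen/genA.
Qed.

End Ideals.

(** * Maximal minors and the degree [n] part of their initial ideal *)

Section Minors.
Set Implicit . Unset Strict Implicit. Unset Printing Implicit Defensive.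
Import GRing.Theory.
Local Open Scope ring_scope.
Variables (k : fieldType) (n m : nat) (lt : term_order (n * m)).
Implicit Types (c g : 'I_n -> 'I_m) (s t : 'S_n) (f p : {mpoly k[n * m]}).

Lemma var_idx_eq (i i' : 'I_n) (j j' : 'I_m) :
  (var_idx i j == var_idx i' j') = (i == i') && (j == j').
Proof.
by rewrite /var_idx /mxvec_index (inj_eq (@cast_ord_inj _ _ _)) (inj_eq enum_rank_inj).
Qed.

Lemma choice_monE c i j : choice_mon c (var_idx i j) = (c i == j).
Proof.
rewrite mnm_sumE (bigD1 i) //= big1 => [|i' ii']; rewrite mnm1E var_idx_eq.
  by rewrite eqxx addn0.
by rewrite (negPf ii').
Qed.

Lemma choice_mon_inj c g : choice_mon c = choice_mon g -> c =1 g.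
Proof.
move/mnmP=> cg i; have := cg (var_idx i (c i)).
by rewrite !choice_monE eqxx; case: eqP.
Qed.

Lemma eq_choice_mon {c g} : c =1 g -> choice_mon c = choice_mon g.
Proof. by move=> cg; apply: eq_bigr => i _; rewrite cg. Qed.

Lemma mdeg_choice_mon c : mdeg (choice_mon c) = n.
Proof.
rewrite mdeg_sum (eq_bigr (fun=> 1%N)) ?sum1_card ?card_ord // => i _.
exact: mdeg1.
Qed.

Lemma perm_of_same_range {c g} :
    injective c -> injective g -> (forall i, c i \in codom g) ->
  exists t : 'S_n, c =1 g \o t.
Proof.
move=> c_inj g_inj cg; pose h i := iinv (cg i).
have gh i : g (h i) = c i by apply: f_iinv.
have h_inj : injective h by move=> i j hij; apply: c_inj; rewrite -!gh hij.
by exists (perm h_inj) => i; rewrite /= permE gh.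
Qed.

Lemma det_colsub_generic g :
  \det (colsub g (generic_mx k n m)) =
    \sum_(s : 'S_n) (-1) ^+ s *: 'X_[choice_mon (g \o s)].
Proof.
apply: eq_bigr => s _; rewrite -mul_mpolyC rmorphXn rmorphN1; congr (_ * _).
by rewrite -mprodXE; apply: eq_bigr => i _; rewrite !mxE.
Qed.

Lemma mcoeff_det_colsub g c :
  (\det (colsub g (generic_mx k n m)))@_(choice_mon c) =
    \sum_(s : 'S_n) (-1) ^+ s *+ (choice_mon (g \o s) == choice_mon c).
Proof.
rewrite det_colsub_generic raddf_sum /=; apply: eq_bigr => s _.
by rewrite mcoeffZ mcoeffX mulr_natr.
Qed.

(** The second condition is separate because in characteristic 2 the sign rule does not force a
    coefficient with a repeated column to vanish. *)
Definition alternating f :=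
  (forall c t, f@_(choice_mon (c \o t)) = (-1) ^+ t * f@_(choice_mon c)) /\
  (forall c, ~ injective c -> f@_(choice_mon c) = 0).

Lemma alternating_det_colsub g :
  injective g -> alternating (\det (colsub g (generic_mx k n m))).
Proof.
move=> g_inj; split=> [c t|c c_ninj]; rewrite !mcoeff_det_colsub; last first.
  rewrite big1 // => s _; case: eqP => // /choice_mon_inj gs; case: c_ninj.
  by move=> i j cij; apply/(@perm_inj _ s)/g_inj; have := gs i; rewrite cij -gs.
rewrite (reindex_inj (mulgI t)) mulr_sumr; apply: eq_bigr => s _.
rewrite odd_permM signr_addb -mulrnAr; congr (_ * (_ *+ nat_of_bool _)).
apply/eqP/eqP => /choice_mon_inj E; apply: eq_choice_mon => i /=.
  by have := E (t^-1 i)%g; rewrite /= permM !permKV.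
by rewrite permM; apply: E.
Qed.

Lemma max_minor_supp (I : {set 'I_m}) (hI : #|I| = n) a :
  a \in msupp (max_minor k hI) ->
  exists2 c, injective c & a = choice_mon c /\ forall i, c i \in I.
Proof.
rewrite /max_minor det_colsub_generic => /msupp_sum_le/flattenP[_ /mapP[s _ ->]].
move/msuppZ_le; rewrite msuppX inE => /eqP->.
eexists; last by split; [reflexivity | move=> i; apply: enum_valP].
by move=> i j /enum_val_inj/cast_ord_inj/perm_inj.
Qed.

Lemma minors_ideal_low f a :
  minors_ideal k n m f -> a \in msupp f -> (n <= mdeg a)%N.
Proof.
move=> /ideal_gen_supp/[apply] -[g [b [[I [hI ->]] /max_minor_supp[c _ [-> _]]]]].
by move/mdeg_lem; rewrite mdeg_choice_mon.
Qed.

(** Minors are homogeneous of degree [n], so in that degree only the constant terms of the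
    multipliers survive, and scalar combinations preserve alternation. *)
Lemma minors_ideal_alternating {f} : minors_ideal k n m f -> alternating f.
Proof.
move=> [r [p [g [gM ->]]]].
have g_alt i : alternating (g i).
  have [I [hI ->]] := gM i; apply: alternating_det_colsub.
  by move=> j j' /enum_val_inj/cast_ord_inj.
have coef c : (\sum_i p i * g i)@_(choice_mon c) =
              \sum_i (p i)@_0 * (g i)@_(choice_mon c).
  rewrite raddf_sum; apply: eq_bigr => i _; apply: mcoeffM_low => b.
  have [I [hI ->]] := gM i => /max_minor_supp[d _ [-> _]].
  by rewrite !mdeg_choice_mon.
split=> [c t|c c_ninj]; rewrite !coef; last first.
  by rewrite big1 // => i _; rewrite (g_alt i).2 // mulr0.
by rewrite mulr_sumr; apply: eq_bigr => i _; rewrite (g_alt i).1 mulrCA.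
Qed.

(** Equivalently, the choice monomial is the lead monomial of the minor on the [n] distinct columns
    [c i]. *)
Definition dominant c :=
  injective c /\ forall s, lt (choice_mon (c \o s)) (choice_mon c).

Lemma choice_mon_max_minor {I : {set 'I_m}} (hI : #|I| = n) {c} :
    injective c -> (forall i, c i \in I) ->
  choice_mon c \in msupp (max_minor k hI).
Proof.
move=> c_inj cI; rewrite mcoeff_msupp mcoeff_det_colsub.
set g := fun r : 'I_n => _.
have g_inj : injective g by move=> j j' /enum_val_inj/cast_ord_inj.
have [i|t ct] := perm_of_same_range c_inj g_inj.
  apply/codomP; exists (cast_ord hI (enum_rank_in (cI i) (c i))).
  by rewrite /g cast_ordK enum_rankK_in.
(* As [g] is injective, distinct permutations give distinct monomials: only [t] contributes and
   nothing cancels. *)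
rewrite (bigD1 t) //= big1 => [|s ts].
  by rewrite addr0 -(eq_choice_mon ct) eqxx signr_eq0.
case: eqP => // /choice_mon_inj gs; case/eqP: ts; apply/permP => i.
by apply: g_inj; have := gs i; rewrite ct.
Qed.

Lemma in_G_choiceP c :
  in_G (initial_ideal lt (minors_ideal k n m)) (choice_mon c) <-> dominant c.
Proof.
have XX (a : 'X_{1..n * m}) : a \in msupp ('X_[a] : {mpoly k[n * m]}).
  by rewrite msuppX mem_head.
split=> [/in_G_initialP[cK _] | [c_inj c_max]].
  (* The lead monomial of [h] divides a monomial of degree [n], and the minors ideal has no term of
     lower degree, so the two agree. *)
  have [h [hM h0 le_hc]] := initial_supp cK (XX _).
  have hc : lead_mon lt h = choice_mon c.
    apply: lem_mdeg_eq le_hc _; rewrite mdeg_choice_mon.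
    exact: minors_ideal_low hM (lead_mon_supp _ h0).
  have [h_alt h_inj] := minors_ideal_alternating hM.
  have hc0 : h@_(choice_mon c) != 0 by rewrite -hc -mcoeff_msupp lead_mon_supp.
  split=> [|s]; first by apply: NNPP => /h_inj h_c; rewrite h_c eqxx in hc0.
  (* By alternation every row permutation of [c] occurs in [h], hence lies below its lead
     monomial. *)
  rewrite -hc; apply: lead_mon_ge.
  by rewrite mcoeff_msupp h_alt mulf_neq0 ?signr_eq0.
(* Conversely, the minor on the columns of [c] has the choice monomial as lead monomial; having the
   least possible degree, it is minimal. *)
have hI : #|[set c i | i : 'I_n]| = n by rewrite card_imset ?card_ord.
have cM := choice_mon_max_minor hI c_inj (fun i => imset_f _ isT).
have Mc : lead_mon lt (max_minor k hI) = choice_mon c.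
  apply: lead_mon_eq => // a /max_minor_supp[d d_inj [-> dI]].
  have [i|t /eq_choice_mon->//] := perm_of_same_range d_inj c_inj.
  by have /imsetP[i' _ ->] := dI i; apply: codom_f.
apply/in_G_initialP; split=> [|b /initial_supp/(_ (XX b))[h [hM h0 le_hb]] le_bc].
  rewrite -Mc; apply: lead_term_initial; last first.
    by apply: contraTneq cM => ->; rewrite msupp0.
  rewrite -[max_minor k hI]mul1r.
  by apply: ideal_genM; exists [set c i | i : 'I_n], hI.
apply: lem_mdeg_eq le_bc _; rewrite mdeg_choice_mon; apply: leq_trans (mdeg_lem le_hb).
exact: minors_ideal_low hM (lead_mon_supp _ h0).
Qed.

End Minors.

(** * Assignments of columns to rows and exchange arguments *)

Section Assignments.
Variables (n m : nat) (lt : term_order (n * m)).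
Implicit Types (phi psi : 'I_m -> option 'I_n) (c : 'I_n -> 'I_m) (T : {set 'I_m}).

(** [None] marks a column outside the domain, so assignments on different column sets share one
    type. *)
Definition cell phi j : 'X_{1..n * m} :=
  if phi j is Some i then U_(var_idx i j)%MM else 0%MM.

Definition asg_mon phi : 'X_{1..n * m} := (\sum_j cell phi j)%MM.

Definition fibre phi i : {set 'I_m} := [set j | phi j == Some i].

Lemma sets_mon_fibre phi : sets_mon (fibre phi) = asg_mon phi.
Proof.
rewrite /sets_mon; under eq_bigr do rewrite big_mkcond /=.
rewrite exchange_big; apply: eq_bigr => j _.
rewrite -big_mkcond /cell; case E: (phi j) => [i|].
  by apply: big_pred1 => i'; rewrite inE E; apply/eqP/eqP => [[]|->].
by apply: big_pred0 => i; rewrite inE E.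
Qed.

Lemma eq_sets_mon (b b' : 'I_n -> {set 'I_m}) :
  b =1 b' -> sets_mon b = sets_mon b'.
Proof. by move=> bb'; apply: eq_bigr => i _; rewrite bb'. Qed.

Lemma mdeg_sets_mon (b : 'I_n -> {set 'I_m}) :
  mdeg (sets_mon b) = \sum_i #|b i|.
Proof.
rewrite mdeg_sum; apply: eq_bigr => i _; rewrite mdeg_sum -sum1_card.
by apply: eq_bigr => j _; rewrite mdeg1.
Qed.

Lemma mdeg_asg_mon phi : mdeg (asg_mon phi) = #|[set j | phi j != None]|.
Proof.
rewrite mdeg_sum -sum1dep_card [RHS]big_mkcond; apply: eq_bigr => j _.
by rewrite /cell; case: (phi j) => [i|]; rewrite ?mdeg1 ?mdeg0.
Qed.

Definition update phi psi T j := if j \in T then psi j else phi j.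

(** The exchanged cells are added on both sides because subtraction of monomials is truncated. *)
Lemma asg_mon_update phi psi T :
  (asg_mon (update phi psi T) + \sum_(j in T) cell phi j =
     asg_mon phi + \sum_(j in T) cell psi j)%MM.
Proof.
rewrite /asg_mon (bigID (mem T)) [in RHS](bigID (mem T)) /=.
rewrite (eq_bigr (cell psi)) => [|j jT]; last by rewrite /cell /update jT.
rewrite [X in (_ + X + _)%MM](eq_bigr (cell phi)) => [|j jT].
  by rewrite addmC addmA -!addmA; congr (_ + _)%MM; apply: addmC.
by rewrite /cell /update (negPf jT).
Qed.

Lemma card_fibre_update phi psi T i :
    #|fibre phi i :&: T| = #|fibre psi i :&: T| ->
  #|fibre (update phi psi T) i| = #|fibre phi i|.
Proof.
move=> eqT; rewrite -(cardsID T) -[in RHS](cardsID T) eqT; congr (_ + _).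
  by apply: eq_card => j; rewrite !inE /update; case: ifP => //; rewrite !andbF.
by apply: eq_card => j; rewrite !inE /update; case: ifP.
Qed.

Definition same_type phi psi :=
  (forall i, #|fibre phi i| = #|fibre psi i|) /\
  (forall j, (phi j == None) = (psi j == None)).

Definition optimal phi :=
  forall psi, same_type phi psi -> lt (asg_mon psi) (asg_mon phi).

Lemma optimal_dominant phi c :
  optimal phi -> (forall i, phi (c i) = Some i) -> dominant lt c.
Proof.
move=> phi_opt phic.
have c_inj : injective c by move=> i i' cii'; apply: Some_inj; rewrite -!phic cii'.
split=> // s; pose T := [set c i | i in 'I_n].
(* [psi] puts column [c (s i)] in row [i], so replacing [phi] by [psi] on [T] trades one column for
   one in every row. *)
pose psi j := omap (s^-1)%g (phi j).
have := asg_mon_update phi psi T.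
have -> : (\sum_(j in T) cell phi j)%MM = choice_mon c.
  rewrite big_imset => [|i i' _ _]; last exact: c_inj.
  by apply: eq_bigr => i _; rewrite /cell phic.
have -> : (\sum_(j in T) cell psi j)%MM = choice_mon (c \o s).
  rewrite big_imset => [|i i' _ _]; last exact: c_inj.
  rewrite (reindex_inj (@perm_inj _ s)); apply: eq_bigr => i _.
  by rewrite /cell /psi phic /= permK.
move=> upd; rewrite -(tle_add2l lt _ _ (asg_mon phi)) -upd tle_add2r.
apply: phi_opt; split=> [i|j]; last first.
  by rewrite /update; case: ifP => // _; rewrite /psi; case: (phi j).
rewrite card_fibre_update //.
have phiT : fibre phi i :&: T = [set c i].
  apply/setP => j; rewrite !inE; apply/andP/eqP => [[/eqP phij /imsetP[i' _ jE]]|->].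
    by move: phij; rewrite jE phic => -[->].
  by rewrite phic eqxx imset_f.
have psiT : fibre psi i :&: T = [set c (s i)].
  apply/setP => j; rewrite !inE; apply/andP/eqP => [[/eqP psij /imsetP[i' _ jE]]|->].
    by move: psij; rewrite jE /psi phic => -[<-]; rewrite permKV.
  by rewrite /psi phic /= permK eqxx imset_f.
by rewrite phiT psiT !cards1.
Qed.

(* Where [psi] moves elements out of rows of [phi], each row that loses an element
   gains one, so following moved elements eventually runs along disjoint cycles;
   undoing these moves is the permutation of a choice of [phi]. *)
Lemma dominant_optimal phi :
    (forall i, fibre phi i != set0) ->
    (forall c, (forall i, phi (c i) = Some i) -> dominant lt c) ->
  optimal phi.
Proof.
(* Induction on the number of columns where the two assignments disagree. *)
move=> phi0 dom psi; have [d] := ubnP #|[set j | phi j != psi j]|.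
elim: d psi => // d IHd psi; rewrite ltnS => le_d [card_eq none_eq].
have [eq_pp|[j0]] := set_0Vmem [set j | phi j != psi j].
  suff -> : asg_mon psi = asg_mon phi by apply: tle_refl.
  apply: eq_bigr => j _; have : j \notin [set j | phi j != psi j].
    by rewrite eq_pp inE.
  by rewrite inE negbK /cell => /eqP->.
rewrite inE => j0_diff; pose bad := [set i | ~~ (fibre phi i \subset fibre psi i)].
(* A bad row loses a column on passing from [phi] to [psi]; [e] picks such a column there and any
   column in the other rows, so it is a choice for [phi]. *)
have /fin_all_exists[e eP] i :
    exists j, phi j = Some i /\ (i \in bad -> psi j != Some i).
  have [i_bad|i_ok] := boolP (i \in bad).
    by move: i_bad; rewrite inE => /subsetPn[j]; rewrite !inE => /eqP ? ?; exists j.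
  by have /set0Pn[j] := phi0 i; rewrite inE => /eqP; exists j.
(* The row receiving [e i] gains a column; its fibre size being unchanged, it also loses one. *)
have bad_next i : i \in bad -> exists2 i', psi (e i) = Some i' & i' \in bad.
  move=> i_bad; have [phi_e /(_ i_bad) psi_e] := eP i.
  case E: (psi (e i)) => [i'|]; last first.
    by have := none_eq (e i); rewrite phi_e E.
  exists i' => //; rewrite inE; apply/negP => sub.
  have /setP/(_ (e i)) : fibre phi i' = fibre psi i'.
    by apply/eqP; rewrite eqEcard sub card_eq leqnn.
  rewrite !inE phi_e E eqxx => /eqP[ii']; by rewrite E ii' eqxx in psi_e.
have /fin_all_exists[nx nxP] i :
    exists i', i \in bad -> psi (e i) = Some i' /\ i' \in bad.
  have [/bad_next[i' ? ?]|_] := boolP (i \in bad).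
    by exists i'.
  by exists i.
pose clsd (S : {set 'I_n}) := [&& S != set0, S \subset bad & [forall i in S, nx i \in S]].
have bad_clsd : clsd bad.
  apply/and3P; split=> //; last by apply/forall_inP => i /nxP[].
  case E: (phi j0) => [i|]; last first.
    by have := none_eq j0; move: j0_diff; rewrite E eqxx eq_sym => /negPf->.
  apply/set0Pn; exists i; rewrite inE; apply/subsetPn; exists j0; rewrite inE ?E //.
  by rewrite -E eq_sym.
(* A minimal closed set replaces the search for a cycle: its image under [nx] is again closed, hence
   all of it, so [nx] permutes it. *)
have [S /minsetP[/and3P[S0 S_bad /forall_inP S_nx] S_min] _] := minset_exists bad_clsd.
have nxS : nx @: S = S.
  have sub : nx @: S \subset S by apply/subsetP => _ /imsetP[i iS ->]; apply: S_nx.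
  apply: S_min => //; apply/and3P; split; last by apply/forall_inP => i /(subsetP sub)/imset_f->.
    by have /set0Pn[i iS] := S0; apply/set0Pn; exists (nx i); apply: imset_f.
  exact: subset_trans sub S_bad.
have nx_inj : {in S &, injective nx} by apply/imset_injP; rewrite nxS.
pose h i := if i \in S then nx i else i.
have h_inj : injective h.
  move=> i i'; rewrite /h; case: ifP => iS; case: ifP => i'S // E.
  - exact: nx_inj.
  - by rewrite -E S_nx in i'S.
  - by rewrite E S_nx in iS.
pose s := perm h_inj.
have sS i : i \in S -> s i = nx i by rewrite permE /h => ->.
have s_mem i : (s i \in S) = (i \in S).
  by rewrite permE /h; case: ifP => [/S_nx|].
have e_inj : injective e.
  by move=> i i' eii'; apply: Some_inj; rewrite -(eP i).1 -(eP i').1 eii'.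
have psi_e i : i \in S -> psi (e i) = Some (nx i).
  by move=> /(subsetP S_bad)/nxP[].
have [_ /(_ s^-1)%g] := dom e (fun i => (eP i).1).
pose T := [set e i | i in S].
have e_inj' : {in S &, injective e} by move=> i i' _ _; apply: e_inj.
have phiT : (\sum_(j in T) cell phi j = \sum_(i in S) U_(var_idx i (e i)))%MM.
  by rewrite big_imset //; apply: eq_bigr => i _; rewrite /cell (eP i).1.
have psiT : (\sum_(j in T) cell psi j = \sum_(i in S) U_(var_idx (s i) (e i)))%MM.
  by rewrite big_imset //; apply: eq_bigr => i iS; rewrite /cell psi_e // sS.
have -> : choice_mon (e \o s^-1)%g = (\sum_i U_(var_idx (s i) (e i)))%MM.
  rewrite /choice_mon (reindex_inj (@perm_inj _ s)).
  by apply: eq_bigr => i _; rewrite /= permK.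
(* Rows outside [S] are fixed by [s] and cancel, leaving a comparison of [psi] with [phi] on [T]. *)
rewrite /choice_mon (bigID (mem S)) [X in lt _ X](bigID (mem S)) /= -phiT -psiT.
rewrite [X in lt (_ + X)%MM _](eq_bigr (fun i => U_(var_idx i (e i)))%MM); last first.
  by move=> i iS; rewrite permE /h (negPf iS).
(* Restoring [phi] on [T] does not lower the monomial and removes disagreements, so the induction
   hypothesis applies. *)
rewrite tle_add2r => le_T; pose psi' := update psi phi T.
apply: (tle_trans (y := asg_mon psi')).
  by rewrite -(tle_add2r lt _ _ (\sum_(j in T) cell psi j)%MM) asg_mon_update tle_add2l.
apply: IHd.
  apply: leq_trans le_d; apply: proper_card; apply/properP; split.
    by apply/subsetP => j; rewrite !inE /psi' /update; case: ifP; rewrite ?eqxx.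
  have /set0Pn[i iS] := S0; exists (e i); rewrite inE /psi' /update ?imset_f ?eqxx //.
  by rewrite (eP i).1 eq_sym (eP i).2 // (subsetP S_bad).
split=> [i|j]; last by rewrite /psi' /update; case: ifP.
(* Within [T], row [i] holds [e i] under [phi] and [e (s^-1 i)] under [psi] if [i] is in [S], and
   nothing otherwise. *)
rewrite card_fibre_update ?card_eq //.
have -> : fibre phi i :&: T = e @: (S :&: [set i]).
  apply/setP => j; rewrite !inE; apply/andP/imsetP => [[phij /imsetP[i' i'S jE]]|].
    by exists i' => //; move: phij; rewrite jE (eP i').1 !inE i'S => /eqP[->] /=.
  by move=> [i']; rewrite !inE => /andP[i'S /eqP ii'] ->; rewrite (eP i').1 ii' eqxx imset_f -?ii'.
have -> : fibre psi i :&: T = e @: (s @^-1: (S :&: [set i])).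
  apply/setP => j; rewrite !inE; apply/andP/imsetP => [[psij /imsetP[i' i'S jE]]|].
    exists i' => //; move: psij; rewrite jE psi_e // !inE s_mem i'S /= => /eqP[<-].
    by rewrite sS.
  move=> [i']; rewrite !inE s_mem => /andP[i'S /eqP<-] ->.
  by rewrite psi_e // sS // eqxx imset_f.
by rewrite !card_imset // card_preimset //; apply: perm_inj.
Qed.

Definition asg_of (b : 'I_n -> {set 'I_m}) j := [pick i | j \in b i].

Lemma fibre_asg_of (b : 'I_n -> {set 'I_m}) : (forall i i' j, j \in b i -> j \in b i' -> i = i') ->
  fibre (asg_of b) =1 b.
Proof.
move=> disj i; apply/setP => j; rewrite inE /asg_of; case: pickP => [i' ji'|j_out].
  by apply/eqP/idP => [[<-]|/(disj _ _ _ ji')->].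
by rewrite j_out.
Qed.

End Assignments.

(** * Multidegrees of the sparse Eagon-Northcott complex *)

Section Multidegrees.
Import GRing.Theory.
Local Open Scope ring_scope.
Variables (k : fieldType) (n m : nat) (lt : term_order (n * m)).
Implicit Types (phi psi : 'I_m -> option 'I_n) (I : {set 'I_m}) (alpha : 'X_{1..n}).

(** These are the assignments met when the recursion for the multidegree is unrolled; the extra
    column in each row comes from the maximal minor in degree 1. *)
Definition valid alpha I phi :=
  (forall i, #|fibre phi i| = (alpha i).+1) /\
  (forall j, (j \in I) = (phi j != None)).

Lemma eq_valid alpha I phi psi :
  phi =1 psi -> valid alpha I phi -> valid alpha I psi.
Proof.
move=> E [cardP domP]; split=> [i|j]; last by rewrite -E.
by rewrite -cardP; apply: eq_card => j; rewrite !inE E.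
Qed.

Lemma eq_asg_mon phi psi : phi =1 psi -> asg_mon phi = asg_mon psi.
Proof. by move=> E; apply: eq_bigr => j _; rewrite /cell E. Qed.

Lemma valid_same_type alpha I phi psi :
  valid alpha I phi -> same_type phi psi -> valid alpha I psi.
Proof.
move=> [cardP domP] [cardE noneE].
by split=> [i|j]; [rewrite -cardE | rewrite -noneE].
Qed.

Lemma same_type_valid alpha I phi psi :
  valid alpha I phi -> valid alpha I psi -> same_type phi psi.
Proof.
move=> [cardP domP] [cardQ domQ]; split=> [i|j]; first by rewrite cardP cardQ.
by apply: negb_inj; rewrite -domP -domQ.
Qed.

Definition del phi j j' := if j' == j then None else phi j'.

Lemma asg_mon_del phi i j : phi j = Some i ->
  asg_mon phi = (U_(var_idx i j) + asg_mon (del phi j))%MM.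
Proof.
move=> phij; rewrite /asg_mon (bigD1 j) //= [in RHS](bigD1 j) //=.
rewrite /cell phij /del eqxx add0m; congr (_ + _)%MM.
by apply: eq_bigr => j' /negPf->.
Qed.

(** Deleting column [j] from row [i] mirrors the term of the differential with coefficient x_ij;
    positivity of [alpha i] keeps the truncated subtraction exact. *)
Lemma valid_del alpha I phi i j : phi j = Some i -> j \in I -> (0 < alpha i)%N ->
  valid alpha I phi <-> valid (alpha - U_(i))%MM (I :\ j) (del phi j).
Proof.
move=> phij jI alpha_i.
have card_del i' : #|fibre phi i'| = ((i == i') + #|fibre (del phi j) i'|)%N.
  rewrite (cardsD1 j) inE phij; congr (_ + _)%N.
  by apply: eq_card => j'; rewrite !inE /del; case: eqP.
have alphaE i' : alpha i' = ((i == i') + (alpha - U_(i))%MM i')%N.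
  by rewrite mnmBE mnm1E; case: eqP => [<-|_]; rewrite ?subnKC ?subn0.
split=> -[cardP domP]; split=> [i'|j'].
- by have := cardP i'; rewrite card_del alphaE -addnS => /addnI.
- by rewrite in_setD1 /del domP; case: (j' == j).
- by rewrite card_del cardP alphaE addnS.
- by have := domP j'; rewrite !inE /del; case: eqP => // ->; rewrite phij jI.
Qed.

(** The target determines [i] and [j], so the double sum has one nonzero term and no coefficient
    mixes several variables. *)
Lemma EN_diffE l (e : EN_gen n m l.+1) (e' : EN_gen n m l) i j :
    (0 < EN_alpha e i)%N -> j \in EN_set e ->
    EN_alpha e' = (EN_alpha e - U_(i))%MM -> EN_set e' = EN_set e :\ j ->
  @EN_diff k n m l.+1 e e' =
    (-1) ^+ (EN_pos (EN_set e) j).+1 *: 'X_[U_(var_idx i j)].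
Proof.
move=> alpha_i jI alphaE setE; rewrite /= (bigD1 i) //= (bigD1 j) //=.
rewrite alphaE setE !eqxx !big1 /= ?addr0 => [|i' /andP[_ i'i]|j' /andP[j'I j'j]].
- by rewrite -mul_mpolyC rmorphXn rmorphN1.
- rewrite big1 // => j' _; case: eqP => // /mnmP/(_ i).
  by rewrite !mnmBE !mnm1E eqxx (negPf i'i) subn0 subn1 => /eqP; rewrite ltn_eqF // ltn_predL.
- case: eqP => // /setP/(_ j'); by rewrite !inE eqxx j'j j'I.
Qed.

Lemma EN_diff_neq0 l (e : EN_gen n m l.+1) (e' : EN_gen n m l) :
    @EN_diff k n m l.+1 e e' != 0 ->
  exists i j, [/\ (0 < EN_alpha e i)%N, j \in EN_set e,
    EN_alpha e' = (EN_alpha e - U_(i))%MM & EN_set e' = EN_set e :\ j].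
Proof.
move=> d0; apply: NNPP => none; case/eqP: d0; rewrite /= big1 // => i alpha_i.
rewrite big1 // => j jI; case: ifP => // /andP[/eqP ? /eqP ?].
by case: none; exists i, j.
Qed.

Lemma lead_mon_EN_diff l (e : EN_gen n m l.+1) (e' : EN_gen n m l) i j :
    (0 < EN_alpha e i)%N -> j \in EN_set e ->
    EN_alpha e' = (EN_alpha e - U_(i))%MM -> EN_set e' = EN_set e :\ j ->
  lead_mon lt (@EN_diff k n m l.+1 e e') = U_(var_idx i j)%MM /\
  @EN_diff k n m l.+1 e e' != 0.
Proof.
move=> alpha_i jI alphaE setE; rewrite (EN_diffE alpha_i jI) //.
rewrite lead_monZX ?signr_eq0 //; split=> //.
by rewrite -msupp_eq0 msuppMCX ?signr_eq0.
Qed.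

Lemma EN_gen_sub l (e : EN_gen n m l.+1) i j :
    (0 < EN_alpha e i)%N -> j \in EN_set e ->
  exists e' : EN_gen n m l,
    EN_alpha e' = (EN_alpha e - U_(i))%MM /\ EN_set e' = EN_set e :\ j.
Proof.
move=> alpha_i jI; have /andP[/eqP deg_e _] := valP e; rewrite -/(EN_alpha e) in deg_e.
have deg : mdeg (EN_alpha e - U_(i))%MM = l.
  apply: (@addIn 1%N); rewrite [RHS]addn1 -[RHS]deg_e -{1}(mdeg1 i) -mdegD submK //.
  by rewrite lep1mP -lt0n.
have card : #|EN_set e :\ j| = (l + n)%N.
  by have := EN_set_card e; rewrite (cardsD1 j) jI => -[].
have lt_deg : (mdeg (EN_alpha e - U_(i))%MM < l.+1)%N by rewrite deg.
have eP : (mdeg (BMultinom lt_deg, EN_set e :\ j).1 == l) &&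
          (#|(BMultinom lt_deg, EN_set e :\ j).2| == l + n)%N.
  by rewrite /= deg card !eqxx.
by exists (exist _ (BMultinom lt_deg, EN_set e :\ j) eP).
Qed.

Let E := eagon_northcott k n m.

(** Induction on [l]: in degree 1 the assignments are the terms of one minor, and each further
    differential accounts for one more column placed in a row. *)
Lemma sparse_mdeg_max l (e : EN_gen n m l) :
  (exists2 phi, valid (EN_alpha e) (EN_set e) phi &
     sparse_mdeg lt (E := E) (l := l.+1) e = asg_mon phi) /\
  (forall phi, valid (EN_alpha e) (EN_set e) phi ->
     lt (asg_mon phi) (sparse_mdeg lt (E := E) (l := l.+1) e)).
Proof.
elim: l e => [|l IHl] e.
  have alpha0 i : EN_alpha e i = 0%N.
    have /andP[/eqP] := valP e; rewrite -/(EN_alpha e) => + _.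
    by move/eqP; rewrite mdeg_eq0 => /eqP->; rewrite mnm0E.
  pose eI : #|EN_set e| = n := EN_set_card e.
  (* For [alpha] zero a valid assignment is a bijection from the column set to the rows, with
     inverse [c]. *)
  have c_of phi : valid (EN_alpha e) (EN_set e) phi ->
      exists c, [/\ injective c, forall i, c i \in EN_set e &
                    asg_mon phi = choice_mon c].
    move=> [cardP domP].
    have /fin_all_exists[c cP] i : exists j, fibre phi i = [set j].
      by apply/cards1P; rewrite cardP alpha0.
    have phic i : phi (c i) = Some i.
      by have := set11 (c i); rewrite -cP inE => /eqP.
    exists c; split=> [i i' cii'|i|].
    - by apply: Some_inj; rewrite -!phic cii'.
    - by rewrite domP phic.
    - by rewrite -sets_mon_fibre; apply: eq_bigr => i _; rewrite cP big_set1.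
  pose c0 r : 'I_m := enum_val (cast_ord (esym eI) r).
  have c0_inj : injective c0 by move=> i i' /enum_val_inj/cast_ord_inj.
  have c0M := choice_mon_max_minor k eI c0_inj (fun i => enum_valP _).
  have M0 : max_minor k eI != 0 by apply: contraTneq c0M => ->; rewrite msupp0.
  (* Degree 0 has a single basis element, of multidegree 1, so the fold has one term. *)
  have mdegE : sparse_mdeg lt (E := E) (l := 1) e = lead_mon lt (max_minor k eI).
    have [[] _ /= ->] := @bigtmax_attained _ lt _ _
      (fun e' : cbasis E 0 => @cdiff _ _ E 0 e e' != 0)
      (fun e' => lead_mon lt (@cdiff _ _ E 0 e e') + 0)%MM tt (mem_index_enum _) M0.
    exact: addm0.
  rewrite mdegE; split=> [|phi /c_of[c [c_inj cI ->]]]; last first.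
    exact/lead_mon_ge/choice_mon_max_minor.
  have /max_minor_supp[c c_inj [-> cI]] := lead_mon_supp lt M0.
  pose b i := [set c i].
  have disj i i' j : j \in b i -> j \in b i' -> i = i'.
    by rewrite !inE => /eqP-> /eqP/c_inj.
  exists (asg_of b); last first.
    rewrite -sets_mon_fibre (eq_sets_mon (fibre_asg_of disj)).
    by apply: eq_bigr => i _; rewrite big_set1.
  split=> [i|j]; first by rewrite fibre_asg_of // cards1 alpha0.
  have <- : [set c i | i in 'I_n] = EN_set e.
    apply/eqP; rewrite eqEcard card_imset // card_ord eI leqnn andbT.
    by apply/subsetP => _ /imsetP[i _ ->].
  rewrite /asg_of; case: pickP => [i|no_i].
    by rewrite inE => /eqP->; rewrite imset_f.
  by apply/negbTE/imsetP => -[i _ jE]; have := no_i i; rewrite inE jE eqxx.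
have ENalpha_deg : mdeg (EN_alpha e) = l.+1 by have /andP[/eqP] := valP e.
have [i0 alpha_i0] : exists i, (0 < EN_alpha e i)%N.
  apply/existsP; move: ENalpha_deg; apply: contra_eqT.
  rewrite negb_exists => /forallP alpha0; rewrite mdegE big1 // => i _.
  by apply/eqP; rewrite -leqn0 leqNgt alpha0.
pose F (e' : cbasis E l.+1) :=
  (lead_mon lt (@cdiff _ _ E l.+1 e e') + sparse_mdeg lt e')%MM.
pose P (e' : cbasis E l.+1) := @cdiff _ _ E l.+1 e e' != 0.
have mdegE : sparse_mdeg lt (E := E) (l := l.+2) e =
  \big[tmax lt/0%MM]_(e' | P e') F e' by [].
split=> [|phi phiV].
  (* [e0] only witnesses that the differential of [e] is nonzero, so that the maximum is attained at
     some [e1]. *)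
  have [j0 j0I] : exists j, j \in EN_set e.
    by apply/set0Pn; rewrite -card_gt0 EN_set_card.
  have [e0 [alpha_e0 set_e0]] := EN_gen_sub alpha_i0 j0I.
  have [_ e0P] := lead_mon_EN_diff alpha_i0 j0I alpha_e0 set_e0.
  have [e1 /andP[_ /EN_diff_neq0[i [j [alpha_i jI alpha_e1 set_e1]]]] maxE] :=
    @bigtmax_attained _ lt _ _ P F e0 (mem_index_enum _) e0P.
  have [lead1 _] := lead_mon_EN_diff alpha_i jI alpha_e1 set_e1.
  have [[phi phiV mdeg1] _] := IHl e1.
  (* Column [j] is outside the domain of [phi], so placing it in row [i] extends [phi]. *)
  pose psi j' := if j' == j then Some i else phi j'.
  have psij : psi j = Some i by rewrite /psi eqxx.
  have delE : phi =1 del psi j.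
    move=> j'; rewrite /del /psi; case: eqP => // ->.
    have [_ /(_ j)] := phiV; rewrite set_e1 !inE eqxx /=.
    by case: (phi j).
  exists psi.
    apply/(valid_del psij jI alpha_i); rewrite -alpha_e1 -set_e1.
    exact: eq_valid phiV.
  by rewrite mdegE maxE /F [cdiff _ _]/= lead1 (asg_mon_del psij) -(eq_asg_mon delE) mdeg1.
have [cardP domP] := phiV.
(* Removing any column of row [i0] gives an assignment bounded by the induction hypothesis, and the
   corresponding term lies below the maximum. *)
have /set0Pn[j] : fibre phi i0 != set0 by rewrite -card_gt0 cardP.
rewrite inE => /eqP phij.
have jI : j \in EN_set e by rewrite domP phij.
have [e0 [alpha_e0 set_e0]] := EN_gen_sub alpha_i0 jI.
have [lead0 e0P] := lead_mon_EN_diff alpha_i0 jI alpha_e0 set_e0.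
have [_ /(_ (del phi j)) le0] := IHl e0.
rewrite (asg_mon_del phij) mdegE.
apply: tle_trans (@tle_bigtmax _ lt _ _ P F e0 (mem_index_enum _) e0P).
rewrite /F [cdiff _ _]/= lead0 tle_add2l; apply: le0.
by rewrite alpha_e0 set_e0; apply/(valid_del phij jI alpha_i0).
Qed.

End Multidegrees.

(** * Multidegrees as fibre families of optimal assignments *)

Theorem corollary2p17 (k : fieldType) (n m : nat) (hnm : (n <= m)%N)
    (lt : term_order (n * m)) (l : nat) (hl : (0 < l)%N) (a : 'X_{1..n * m}) :
  multidegree_in (sparse_eagon_northcott k lt) l a <->
  exists b : 'I_n -> {set 'I_m},
    [/\ forall i, b i != set0,
        a = sets_mon b,
        mdeg a = (n + l - 1)%N
      & forall c : 'I_n -> 'I_m, (forall i, c i \in b i) ->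
          in_G (initial_ideal lt (minors_ideal k n m)) (choice_mon c)].
Proof.
(* From here on [l] is the homological degree minus one. *)
case: l hl => // l _; split=> [[e aE] | [b [b0 -> deg_b dom]]].
  have /= [[phi phiV mdegE] max_e] := sparse_mdeg_max k lt e.
  have [cardP _] := phiV; have {mdegE}aE' : a = asg_mon phi by rewrite -aE -mdegE.
  exists (fibre phi); split=> [i|||c c_phi].
  - by rewrite -card_gt0 cardP.
  - by rewrite sets_mon_fibre.
  - rewrite aE' -sets_mon_fibre mdeg_sets_mon (eq_bigr _ (fun i _ => cardP i)).
    under eq_bigr do rewrite -addn1; rewrite big_split sum1_card card_ord -mdegE.
    by have /andP[/eqP-> _] := valP e; rewrite /= addnS subn1 addnC.
  - apply/in_G_choiceP; apply: (@optimal_dominant _ _ _ phi) => [psi psiT|i].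
      by rewrite -aE' -aE; apply: max_e; apply: valid_same_type psiT.
    by have := c_phi i; rewrite inE => /eqP.
have {}dom c : (forall i, c i \in b i) -> dominant lt c.
  by move=> cb; apply/in_G_choiceP/dom.
(* A column shared by two rows could be chosen for both, but dominant choices are injective. *)
have disj i i' j : j \in b i -> j \in b i' -> i = i'.
  move=> ji ji'; have /fin_all_exists[c cb] x : exists j, j \in b x by apply/set0Pn.
  have [|c_inj _] := dom (fun x => if (x == i) || (x == i') then j else c x).
    by move=> x; case: ifP => // /orP[]/eqP->.
  by apply: c_inj; rewrite !eqxx orbT.
pose phi := asg_of b; have fibreE : fibre phi =1 b := fibre_asg_of disj.
have bE : sets_mon b = asg_mon phi by rewrite -sets_mon_fibre (eq_sets_mon fibreE).
have deg_phi : mdeg (asg_mon phi) = (l + n)%N.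
  by rewrite -bE deg_b addnS subn1 addnC.
(* Each [b i] is nonempty, so its size minus one is an honest exponent; [I] below is the union of
   the [b i]. *)
pose alpha := [multinom #|b i|.-1 | i < n].
have alphaE i : #|b i| = (alpha i).+1 by rewrite mnmE prednK ?card_gt0.
pose I := [set j | phi j != None].
have deg_alpha : mdeg alpha = l.
  move: deg_phi; rewrite -bE mdeg_sets_mon (eq_bigr _ (fun i _ => alphaE i)).
  under eq_bigr do rewrite -addn1; rewrite big_split sum1_card card_ord -mdegE.
  by move/addIn.
have lt_alpha : (mdeg alpha < l.+1)%N by rewrite deg_alpha.
have eP : (mdeg (BMultinom lt_alpha, I).1 == l) && (#|(BMultinom lt_alpha, I).2| == l + n)%N.
  by rewrite /= deg_alpha -deg_phi mdeg_asg_mon !eqxx.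
pose e : EN_gen n m l := exist _ (BMultinom lt_alpha, I) eP; exists e.
have phiV : valid (EN_alpha e) (EN_set e) phi.
  split=> [i|j]; last by rewrite inE.
  by rewrite fibreE alphaE.
have /= [[psi psiV mdegE] max_e] := sparse_mdeg_max k lt e.
(* [psi] realizes the maximum over valid assignments and [phi] is optimal of the same type, so each
   monomial bounds the other. *)
rewrite bE; apply: (etrans mdegE); apply: (tle_anti (t := lt)).
rewrite -{2}mdegE max_e // andbT.
apply: (@dominant_optimal _ _ _ phi) => [i|c cb|]; last exact: same_type_valid psiV.
  by rewrite fibreE.
by apply: dom => i; rewrite -fibreE inE cb.
Qed.
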